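(* Let $G_1$ be an $r_1$-regular graph with $n_1$ vertices and $m_1$ edges and let $G_2$ be an arbitrary graph with $n_2$ vertices. Then the number of spanning trees of the central vertex corona $G_1\odot G_2$ is $$t(G_1\odot G_2)=\frac{2^{m_1-n_1}(r_1+2n_2+2)\prod_{j=2}^{n_2}(1+\mu_j(G_2))^{n_1}\prod_{i=2}^{n_1}(2n_1-r_1+\lambda_i(G_1))}{n_1+m_1+n_1n_2}.$$
   Context: All graphs are finite, simple and connected. For a graph $G$ on $n$ vertices, $A(G)$ is its adjacency matrix with eigenvalues $\lambda_1(G)\ge\dots\ge\lambda_n(G)$; $L(G)=D(G)-A(G)$ is the Laplacian matrix ($D(G)$ the diagonal matrix of vertex degrees) with eigenvalues $0=\mu_1(G)<\mu_2(G)\le\dots\le\mu_n(G)$; $t(G)$ is the number of spanning trees of $G$. The central graph $C(G)$ of $G$ is obtained from $G$ by subdividing each edge of $G$ exactly once and joining all pairs of distinct vertices of $G$ that are nonadjacent in $G$. The central vertex corona $G_1\odot G_2$ is obtained by taking one copy of $C(G_1)$ and $|V(G_1)|$ copies of $G_2$, and joining the vertex $v_i$ of $G_1$ (viewed in $C(G_1)$) to every vertex in the $i$-th copy of $G_2$, for each $i$. *)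

(* Defs.v *)
From mathcomp Require Import all_boot all_order all_algebra all_field.

Set Implicit Arguments.
Unset Strict Implicit.
Unset Printing Implicit Defensive.

Import Order.TTheory GRing.Theory Num.Theory.

Local Open Scope ring_scope.

Record sgraph := SGraph {
  vertex :> finType;
  adj : rel vertex;
  adj_sym : symmetric adj;
  adj_irr : irreflexive adj
}.

Definition edges (G : sgraph) : {set {set G}} :=
  [set e : {set G} |
     [exists x : G, exists y : G, adj x y && (e == [set x; y])]].

Definition degree (G : sgraph) (x : G) : nat := #|[set y : G | adj x y]|.

Definition regular (r : nat) (G : sgraph) : Prop :=
  forall x : G, degree x = r.

(* The graph with no vertices is not considered connected. *)
Definition connected_rel (T : finType) (e : rel T) : bool :=
  (0 < #|T|)%N && [forall x : T, forall y : T, connect e x y].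

(* A cycle has k >= 3 pairwise distinct vertices. Bounding k by #|T| loses
   nothing and keeps the predicate boolean. *)
Definition acyclic_rel (T : finType) (e : rel T) : bool :=
  [forall k : 'I_#|T|.+1, forall c : k.-tuple T,
     ~~ [&& (2 < k)%N, uniq c & cycle e c]].

Definition connected (G : sgraph) : bool := connected_rel (@adj G).

Definition span_rel (G : sgraph) (S : {set {set G}}) : rel G :=
  [rel x y | [set x; y] \in S].

Definition spanning_tree (G : sgraph) (S : {set {set G}}) : bool :=
  [&& S \subset edges G, connected_rel (span_rel S) & acyclic_rel (span_rel S)].

Definition num_spanning_trees (G : sgraph) : nat :=
  #|[set S : {set {set G}} | spanning_tree S]|.

Definition adjmx (G : sgraph) : 'M[algC]_#|G| :=
  \matrix_(i, j) (adj (enum_val i) (enum_val j))%:R.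

Definition degmx (G : sgraph) : 'M[algC]_#|G| :=
  diag_mx (\row_i (degree (enum_val i))%:R).

Definition laplmx (G : sgraph) : 'M[algC]_#|G| := degmx G - adjmx G.

(* The roots of the characteristic polynomial, listed with multiplicity;
   see eigenvaluesP. *)
Definition eigenvalues (n : nat) (M : 'M[algC]_n) : seq algC :=
  sval (closed_field_poly_normal (char_poly M)).

Lemma eigenvaluesP (n : nat) (M : 'M[algC]_n) :
  char_poly M = \prod_(x <- eigenvalues M) ('X - x%:P).
Proof.
rewrite /eigenvalues; case: closed_field_poly_normal => s /= {1}->.
by rewrite (monicP (char_poly_monic M)) scale1r.
Qed.

Lemma size_eigenvalues (n : nat) (M : 'M[algC]_n) : size (eigenvalues M) = n.
Proof.
have := size_char_poly M.
by rewrite eigenvaluesP size_prod_XsubC => -[].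
Qed.

(* adjmx G and laplmx G are real symmetric, so all their eigenvalues are real
   and the order of algC, which is only partial, is total on them. The indices
   i and j below start at 1: lambda_ G 1 >= ... >= lambda_ G #|G| and
   mu_ G 1 <= ... <= mu_ G #|G|. *)
Definition lambda_ (G : sgraph) (i : nat) : algC :=
  (sort >=%R (eigenvalues (adjmx G)))`_i.-1.

Definition mu_ (G : sgraph) (j : nat) : algC :=
  (sort <=%R (eigenvalues (laplmx G)))`_j.-1.

(* inl x is the vertex x of G, inr e is the vertex subdividing the edge e. *)
Definition central_vertex (G : sgraph) : finType :=
  (G + {e : {set G} | e \in edges G})%type.

Definition central_adj (G : sgraph) (u v : central_vertex G) : bool :=
  match u, v with
  | inl x, inl y => (x != y) && ~~ adj x y
  | inl x, inr e => x \in val e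
  | inr e, inl x => x \in val e
  | inr _, inr _ => false
  end.

Lemma central_adj_sym (G : sgraph) : symmetric (@central_adj G).
Proof. by move=> [x|e] [y|f] //=; rewrite eq_sym adj_sym. Qed.

Lemma central_adj_irr (G : sgraph) : irreflexive (@central_adj G).
Proof. by move=> [x|e] //=; rewrite eqxx. Qed.

Definition central_graph (G : sgraph) : sgraph :=
  SGraph (@central_adj_sym G) (@central_adj_irr G).

(* inr (x, w) is the vertex w of the copy of G2 attached to the vertex x of
   G1. *)
Definition corona_vertex (G1 G2 : sgraph) : finType :=
  (central_graph G1 + G1 * G2)%type.

Definition corona_adj (G1 G2 : sgraph) (u v : corona_vertex G1 G2) : bool :=
  match u, v with
  | inl a, inl b => adj a b
  | inl a, inr (x, _) => a == inl x
  | inr (x, _), inl b => b == inl x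
  | inr (x, w), inr (y, z) => (x == y) && adj w z
  end.

Lemma corona_adj_sym (G1 G2 : sgraph) : symmetric (@corona_adj G1 G2).
Proof.
move=> [a|[x w]] [b|[y z]].
- exact: (@adj_sym (central_graph G1)).
- by [].
- by [].
- by rewrite /= eq_sym adj_sym.
Qed.

Lemma corona_adj_irr (G1 G2 : sgraph) : irreflexive (@corona_adj G1 G2).
Proof.
move=> [a|[x w]]; first exact: (@adj_irr (central_graph G1)).
by rewrite /= adj_irr andbF.
Qed.

Definition central_vertex_corona (G1 G2 : sgraph) : sgraph :=
  SGraph (@corona_adj_sym G1 G2) (@corona_adj_irr G1 G2).

(* Main.v *)
Require Import Defs.
From mathcomp Require Import all_boot all_order all_algebra all_field.
From mathcomp Require Import perm.
From mathcomp Require Import ring.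

(** Write L for the Laplacian of a graph on N vertices.  Its rows and columns
    sum to zero, so for all vectors u and v the determinant of L + u v^T is the
    sum of u times the sum of v times any principal minor of L of size N - 1
    ([fdet_zero_sum_rank1]), and by the matrix-tree theorem that minor is the
    number of spanning trees ([laplacian_rank1_spanning_trees]).

    The matrix-tree theorem is proved by expanding the minor at r in its rows:
    row x is the sum, over the neighbours k of x, of the vector e_x - e_k.
    Multilinearity leaves one determinant for each function f choosing a
    neighbour of every vertex other than r.  It is 1 when iterating f leads from
    every vertex to r (the matrix is unitriangular for the distance to r along
    f) and 0 otherwise (the vertices not leading to r give a kernel vector).
    The functions of the first kind are the parent functions of the spanning
    trees rooted at r.

    For the corona, let u = v be the indicator of the n1 vertices of G1.  This
    turns the block of these vertices into (n1 + n2) I + A(G1), without any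
    all-ones matrix.  Eliminating the copies of G2, on which I + L(G2) fixes the
    all-ones vector, subtracts n2 I from that block; eliminating the m1
    subdividing vertices subtracts half of A(G1) + r1 I.  Hence n1^2 times the
    number of spanning trees is
      2^m1 det(I + L(G2))^n1 det(((2 n1 - r1) I + A(G1)) / 2),
    see [fdet_corona].  Finally 0 is the least eigenvalue of L(G2) and r1 the
    greatest one of A(G1), which isolates the factors 1 and 2 n1, and
    n1 r1 = 2 m1 gives the stated form. *)

Set Implicit Arguments.
Unset Strict Implicit.
Unset Printing Implicit Defensive.

Import Order.TTheory GRing.Theory Num.Theory.

Local Open Scope ring_scope.

(** * Determinants of matrices indexed by a finite type *)

Section FinDet.

Variable R : comNzRingType.
Implicit Types T U : finType.

(** The determinant of the square matrix with rows and columns indexed by the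
    finite type [T]; by [fdet_enum] the enumeration of [T] is irrelevant. *)
Definition fdet T (F : T -> T -> R) : R :=
  \det (\matrix_(i < #|T|, j < #|T|) F (enum_val i) (enum_val j)).

Lemma eq_fdet T (F G : T -> T -> R) : F =2 G -> fdet F = fdet G.
Proof. by move=> eFG; congr (\det _); apply/matrixP=> i j; rewrite !mxE. Qed.

Lemma fdet_enum T (F : T -> T -> R) n (h : 'I_n -> T) :
  bijective h -> fdet F = \det (\matrix_(i, j) F (h i) (h j)).
Proof.
move=> bh; have n_T : n = #|T|.
  by rewrite -[LHS]card_ord; exact: bij_eq_card bh.
subst n; have /injF_bij/bij_inj inj_s : injective (enum_rank \o h).
  by move=> i j /= /enum_rank_inj/(bij_inj bh).
pose s := perm inj_s.
have -> : \matrix_(i, j) F (h i) (h j) =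
    row_perm s (col_perm s (\matrix_(i, j) F (enum_val i) (enum_val j))).
  by apply/matrixP=> i j; rewrite !mxE !permE /= !enum_rankK.
rewrite row_permE col_permE !det_mulmx !det_perm odd_permV.
by rewrite mulrCA -signr_addb addbb mulr1.
Qed.

Lemma fdet_bij T U (g : U -> T) (F : T -> T -> R) :
  bijective g -> fdet F = fdet (fun x y => F (g x) (g y)).
Proof.
move=> bg; rewrite (@fdet_enum _ F #|U| (g \o enum_val)) //.
by apply: bij_comp bg _; apply: enum_val_bij.
Qed.

Lemma fdet_mul T (F G : T -> T -> R) :
  fdet (fun x y => \sum_z F x z * G z y) = fdet F * fdet G.
Proof.
rewrite /fdet -det_mulmx; congr (\det _); apply/matrixP=> i j; rewrite !mxE.
rewrite (reindex (@enum_val T T)) /=; last exact: onW_bij (@enum_val_bij T).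
by apply: eq_bigr => k _; rewrite !mxE.
Qed.

Lemma fdet_tr T (F : T -> T -> R) : fdet (fun x y => F y x) = fdet F.
Proof.
by rewrite /fdet -det_tr; congr (\det _); apply/matrixP=> i j; rewrite !mxE.
Qed.

Lemma fdet_scale T c (F : T -> T -> R) :
  fdet (fun x y => c * F x y) = c ^+ #|T| * fdet F.
Proof.
by rewrite /fdet -detZ; congr (\det _); apply/matrixP=> i j; rewrite !mxE.
Qed.

Lemma fdet_scalar T c : fdet (fun x y : T => c * (x == y)%:R) = c ^+ #|T|.
Proof.
rewrite /fdet -[RHS]det_scalar; congr (\det _); apply/matrixP=> i j.
by rewrite !mxE (inj_eq enum_val_inj) mulr_natr.
Qed.

Lemma fdet1 T : fdet (fun x y : T => (x == y)%:R) = 1.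
Proof.
by rewrite -[RHS](expr1n _ #|T|) -fdet_scalar; apply: eq_fdet => x y;
   rewrite mul1r.
Qed.

Lemma fdet_ublock T U (F : T + U -> T + U -> R) :
  (forall u t, F (inr u) (inl t) = 0) ->
  fdet F = fdet (fun x y => F (inl x) (inl y)) *
           fdet (fun x y => F (inr x) (inr y)).
Proof.
move=> F0; pose h (i : 'I_(#|T| + #|U|)) : T + U :=
  match split i with inl a => inl (enum_val a) | inr b => inr (enum_val b) end.
pose k (z : T + U) : 'I_(#|T| + #|U|) := unsplit
  match z with inl a => inl (enum_rank a) | inr b => inr (enum_rank b) end.
have bh : bijective h.
  exists k; last by case=> a; rewrite /h /k unsplitK enum_rankK.
  by move=> i; rewrite -[RHS]splitK /h /k; case: (split i) => a;
     rewrite enum_valK.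
rewrite (fdet_enum _ bh) -[X in \det X]submxK.
have -> : dlsubmx (\matrix_(i, j) F (h i) (h j)) = 0.
  apply/matrixP=> i j; rewrite !mxE.
  by rewrite /h -[lshift _ _]/(unsplit (inl _)) -[rshift _ _]/(unsplit (inr _))
     !unsplitK F0.
rewrite det_ublock; congr (_ * _); congr (\det _);
  apply/matrixP=> i j; rewrite !mxE.
  by rewrite /h -![lshift _ _]/(unsplit (inl _)) !unsplitK.
by rewrite /h -![rshift _ _]/(unsplit (inr _)) !unsplitK.
Qed.

(** The determinant of the Kronecker product of the identity with [B]. *)
Lemma fdet_tensor1 T U (B : U -> U -> R) :
  fdet (fun x y : T * U => (x.1 == y.1)%:R * B x.2 y.2) = fdet B ^+ #|T|.
Proof.
have fdet_ord n :
    fdet (fun x y : 'I_n * U => (x.1 == y.1)%:R * B x.2 y.2) = fdet B ^+ n.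
  elim: n => [|n IHn].
    by rewrite -[RHS](fdet1 ('I_0 * U)%type); apply: eq_fdet => -[[]].
  pose g (z : U + 'I_n * U) : 'I_n.+1 * U :=
    match z with inl u => (ord0, u) | inr (i, u) => (lift ord0 i, u) end.
  pose k (z : 'I_n.+1 * U) : U + 'I_n * U :=
    if unlift ord0 z.1 is Some i then inr (i, z.2) else inl z.2.
  have bg : bijective g.
    exists k; first by case=> [u|[i u]]; rewrite /k /= ?unlift_none ?liftK.
    by case=> i u; rewrite /k /=; case: unliftP => [j|] ->.
  rewrite (fdet_bij _ bg) fdet_ublock; last by case=> i u v; rewrite /= mul0r.
  rewrite exprS -IHn; congr (_ * _); apply: eq_fdet => x y.
    by rewrite mul1r.
  by case: x y => [i u] [j v] /=; rewrite (inj_eq lift_inj).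
rewrite -fdet_ord
  (@fdet_bij _ ('I_#|T| * U)%type (fun z => (enum_val z.1, z.2))).
  by apply: eq_fdet => -[i u] [j v] /=; rewrite (inj_eq enum_val_inj).
exists (fun z => (enum_rank z.1, z.2)) => -[i u] /=; first by rewrite enum_valK.
by rewrite enum_rankK.
Qed.

(** Elimination of the lower left block by column operations: [X] plays the
    role of minus the inverse of the lower right block times the lower left
    one, so no inverse is needed. *)
Lemma fdet_schur T U (F : T + U -> T + U -> R) (X : U -> T -> R) :
  (forall u t, F (inr u) (inl t) + \sum_v F (inr u) (inr v) * X v t = 0) ->
  fdet F =
    fdet (fun x y => F (inl x) (inl y) + \sum_v F (inl x) (inr v) * X v y) *
    fdet (fun x y => F (inr x) (inr y)).
Proof.
move=> FX0; pose E (a b : T + U) : R :=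
  match a, b with inr v, inl y => X v y | _, _ => (a == b)%:R end.
have detE : fdet E = 1.
  rewrite -fdet_tr fdet_ublock //.
  rewrite -[RHS]mulr1 -[X in _ = X * _](fdet1 T) -[X in _ = _ * X](fdet1 U).
  by congr (_ * _); apply: eq_fdet => x y; rewrite eq_sym.
have FE a b : \sum_c F a c * E c b =
    if b is inl y then F a (inl y) + \sum_v F a (inr v) * X v y else F a b.
  rewrite big_sumType /=; case: b => y /=.
    congr (_ + _); rewrite (bigD1 y) //= eqxx mulr1 big1 ?addr0 // => x.
    by move=> /negPf nxy; rewrite /eq_op /= nxy mulr0.
  rewrite big1 ?add0r => [|x _]; last by rewrite mulr0.
  rewrite (bigD1 y) //= eqxx mulr1 big1 ?addr0 // => x /negPf nxy.
  by rewrite /eq_op /= nxy mulr0.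
rewrite -[LHS]mulr1 -detE -fdet_mul (eq_fdet FE) fdet_ublock //.
Qed.

(** The matrix determinant lemma. *)
Lemma fdet_rank1 T (a b : T -> R) :
  fdet (fun x y => (x == y)%:R + a x * b y) = 1 + \sum_x a x * b x.
Proof.
have sum_unit (H : unit -> R) : \sum_u H u = H tt.
  by apply: (big_pred1 tt); case.
have fdet_unit (F : unit -> unit -> R) : fdet F = F tt tt.
  transitivity (fdet (fun x y : unit => F tt tt * (x == y)%:R)).
    by apply: eq_fdet => -[] []; rewrite mulr1.
  by rewrite fdet_scalar card_unit expr1.
(* Eliminating in F' either block off the diagonal gives the two sides. *)
pose F' (p q : unit + T) : R := match p, q with
  | inl _, inl _ => 1
  | inl _, inr y => - b y
  | inr x, inl _ => a x
  | inr x, inr y => (x == y)%:R end.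
have -> : fdet (fun x y => (x == y)%:R + a x * b y) = fdet F'.
  pose g (p : T + unit) : unit + T :=
    match p with inl x => inr x | inr u => inl u end.
  have bg : bijective g.
    by exists (fun p => match p with inl x => inr x | inr u => inl u end); case.
  rewrite (fdet_bij _ bg) (@fdet_schur _ _ _ (fun _ y => b y)) => /=.
    by rewrite fdet_unit mulr1; apply: eq_fdet => x y; rewrite sum_unit.
  by move=> u t; rewrite sum_unit mul1r addNr.
rewrite (@fdet_schur _ _ _ (fun x _ => - a x)) /=.
  rewrite [X in _ * X](_ : _ = 1) ?mulr1; last first.
    exact: fdet1.
  rewrite fdet_unit.
  by congr (_ + _); apply: eq_bigr => x _; rewrite mulrNN mulrC.
move=> x _; rewrite (bigD1 x) //= eqxx mul1r big1 ?addr0 ?subrr // => y.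
by rewrite eq_sym => /negPf->; rewrite mul0r.
Qed.

(** Multilinearity in the rows, expanded all at once. *)
Lemma fdet_row_sum T (U : finType) (Q : T -> pred U) (g : T -> U -> T -> R) :
  fdet (fun x y => \sum_(k | Q x k) g x k y) =
    \sum_(f in family Q) fdet (fun x y => g x (f x) y).
Proof.
rewrite /fdet /determinant exchange_big /=; apply: eq_bigr => s _.
rewrite -big_distrr /=; congr (_ * _).
have big_enum_val (H : T -> R) : \prod_(i < #|T|) H (enum_val i) = \prod_x H x.
  by rewrite (reindex (@enum_val T T)) //; apply: onW_bij (@enum_val_bij T).
transitivity (\prod_x \sum_(k | Q x k) g x k (enum_val (s (enum_rank x)))).
  by rewrite -big_enum_val; apply: eq_bigr => i _; rewrite mxE enum_valK.
rewrite bigA_distr_big_dep; apply: eq_bigr => f _.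
by rewrite -big_enum_val; apply: eq_bigr => i _; rewrite mxE enum_valK.
Qed.

Lemma fdet_unitriangular T (d : T -> nat) (F : T -> T -> R) :
  (forall x, F x x = 1) ->
  (forall x y, x != y -> (d x <= d y)%N -> F x y = 0) -> fdet F = 1.
Proof.
move=> F1 F0.
rewrite /fdet /determinant (bigD1 (1%g : 'S_#|T|)) //= odd_perm1 mul1r.
rewrite big1 ?big1 ?addr0 // => [s s1|i _]; last by rewrite mxE perm1 F1.
have [i si] : exists i, s i != i.
  apply/existsP; apply: contraR s1; rewrite negb_exists => /forallP all_fix.
  by apply/eqP/permP=> i; rewrite perm1; apply/eqP; rewrite -[_ == _]negbK.
(* A moved point of least measure contributes a zero factor. *)
have [j sj minj] :=
  @arg_minnP _ i (fun k => s k != k) (fun k => d (enum_val k)) si.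
rewrite (bigD1 j) //= mxE F0 ?mul0r ?mulr0 //.
  by rewrite (inj_eq enum_val_inj) eq_sym.
by apply: minj; rewrite (inj_eq perm_inj).
Qed.

(** If all rows and columns of [F] sum to zero, a rank one perturbation of [F]
    has determinant the product of the two total weights and of the minor
    obtained by deleting row and column [r]; the minor is expressed by
    replacing row [r] with the corresponding row of the identity. *)
Lemma fdet_zero_sum_rank1 T (r : T) (F : T -> T -> R) (u v : T -> R) :
  (forall x, \sum_y F x y = 0) -> (forall y, \sum_x F x y = 0) ->
  fdet (fun x y => F x y + u x * v y) =
    (\sum_x u x) * (\sum_y v y) *
    fdet (fun x y => if x == r then (x == y)%:R else F x y).
Proof.
move=> row0 col0; pose w y := (r == y)%:R - F r y.
have sum_delta (x : T) (H : T -> R) : \sum_z (x == z)%:R * H z = H x.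
  rewrite (bigD1 x) //= eqxx mul1r big1 ?addr0 // => z.
  by rewrite eq_sym => /negPf->; rewrite mul0r.
have sum_delta1 (x : T) : \sum_z (x == z)%:R = 1 :> R.
  by rewrite -[RHS](sum_delta x); apply: eq_bigr => z _; rewrite mulr1.
have sum_w : \sum_y w y = 1 by rewrite sumrB sum_delta1 row0 subr0.
have -> : fdet (fun x y => if x == r then (x == y)%:R else F x y) =
          fdet (fun x y => F x y + (r == x)%:R * w y).
  apply: eq_fdet => x y; rewrite [r == x]eq_sym; case: eqP => [->|_].
    by rewrite mul1r addrC subrK.
  by rewrite mul0r addr0.
have su : \sum_x u x = fdet (fun x y => (x == y)%:R + (u x - (r == x)%:R) * 1).
  rewrite fdet_rank1; under [in RHS]eq_bigr do rewrite mulr1.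
  by rewrite sumrB sum_delta1 addrC subrK.
have sv : \sum_x v x = fdet (fun x y => (x == y)%:R + 1 * (v y - w y)).
  rewrite fdet_rank1; under [in RHS]eq_bigr do rewrite mul1r.
  by rewrite sumrB sum_w addrC subrK.
(* Replacing row r is adding e_r w^T, and w has total weight 1; multiplying by
   1 + (u - e_r) 1^T on the left and by 1 + 1 (v - w)^T on the right turns
   F + e_r w^T into F + u v^T. *)
rewrite mulrAC su -fdet_mul sv -fdet_mul; apply: eq_fdet => x y.
rewrite (eq_bigr (fun z => (F x z + u x * w z) * ((z == y)%:R + (v y - w y)))).
  rewrite (eq_bigr (fun z => (y == z)%:R * (F x z + u x * w z)
     + (v y - w y) * F x z + (v y - w y) * u x * w z)); last first.
    by move=> z _; rewrite [z == y]eq_sym; ring.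
  by rewrite !big_split /= sum_delta -!mulr_sumr row0 sum_w; ring.
move=> z _; rewrite mul1r; congr (_ * _).
rewrite (eq_bigr (fun t => (x == t)%:R * (F t z + (r == t)%:R * w z)
   + (u x - (r == x)%:R) * F t z
   + (u x - (r == x)%:R) * w z * (r == t)%:R)); last by move=> t _; ring.
rewrite !big_split /= sum_delta -!mulr_sumr col0 sum_delta1; ring.
Qed.

End FinDet.

Lemma fdet_kernel (R : fieldType) (T : finType) (F : T -> T -> R) (v : T -> R)
    (x0 : T) :
  v x0 != 0 -> (forall x, \sum_y F x y * v y = 0) -> fdet F = 0.
Proof.
move=> v0 Fv; rewrite -fdet_tr; apply/eqP/det0P.
exists (\row_i v (enum_val i)).
  apply: contraNneq v0 => /rowP/(_ (enum_rank x0)).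
  by rewrite !mxE enum_rankK => ->.
apply/rowP=> j; rewrite !mxE -[RHS](Fv (enum_val j)).
rewrite [RHS](reindex (@enum_val T T)) /=; last exact: onW_bij (@enum_val_bij T).
by apply: eq_bigr => k _; rewrite !mxE mulrC.
Qed.

(** * The matrix-tree theorem *)

Lemma eq_set2 (T : finType) (x y a b : T) :
  [set x; y] = [set a; b] -> (x = a /\ y = b) \/ (x = b /\ y = a).
Proof.
move/setP=> e; have := e x; have := e y; have := e a; have := e b.
rewrite !inE !eqxx !orbT /= => eb ea ey ex.
case/esym/orP: ex => /eqP ex; subst x; [left | right]; split=> //.
  by case/esym/orP: ey => /eqP // ya; subst y; case/orP: eb => /eqP.
by case/esym/orP: ey => /eqP // yb; subst y; case/orP: ea => /eqP.
Qed.

Section ParentFunctions.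

Variables (G : sgraph) (r : G).
Implicit Types (f g : {ffun G -> G}) (x y z : G) (S : {set {set G}}).

(** The values allowed at [x] for a parent function: [r] itself at the root, a
    neighbour elsewhere. *)
Definition parent_choice x : pred G :=
  fun k => if x == r then k == r else adj x k.

(** A spanning tree of [G] rooted at [r], encoded by the function that sends
    each vertex to its parent and the root to itself. *)
Definition parent_fun f : bool :=
  (f \in family parent_choice) && [forall x, fconnect f x r].

Lemma parent_fun_root f : parent_fun f -> f r = r.
Proof. by case/andP=> /familyP/(_ r); rewrite unfold_in eqxx => /eqP. Qed.

Lemma parent_fun_adj f x : parent_fun f -> x != r -> adj x (f x).
Proof.
case/andP=> /familyP/(_ x); rewrite unfold_in => + _ /negPf xr.
by rewrite xr.
Qed.

Lemma parent_fun_reach f x : parent_fun f -> fconnect f x r.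
Proof. by case/andP=> _ /forallP. Qed.

Lemma findex_parent f x :
  parent_fun f -> x != r -> findex f x r = (findex f (f x) r).+1.
Proof.
by move=> pf xr; rewrite fconnect_findex ?parent_fun_reach // eq_sym.
Qed.

Lemma fdet_parent (R : fieldType) f :
  f \in family parent_choice ->
  fdet (fun x y => (x == y)%:R - ((x != r) && (f x == y))%:R) =
    [forall x, fconnect f x r]%:R :> R.
Proof.
move=> ff; have fr : f r = r.
  by move/familyP: ff => /(_ r); rewrite unfold_in eqxx => /eqP.
case: (boolP [forall x, _]) => [reach | /forallPn[x0 x0r]].
  have pf : parent_fun f by apply/andP.
  apply: (@fdet_unitriangular _ _ (fun x => findex f x r)) => [x | x y xy].
    rewrite eqxx; case: (altP (x =P r)) => [_|xr] /=; first by rewrite subr0.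
    case: eqP => [fx|_]; last by rewrite subr0.
    by have := parent_fun_adj pf xr; rewrite fx adj_irr.
  rewrite (negPf xy); case: (altP (x =P r)) => [_|xr] /=; first by rewrite subr0.
  by case: eqP => [<-|_]; rewrite ?subr0 // findex_parent // ltnn.
(* The indicator of the vertices that do not reach the root is in the kernel. *)
apply: (@fdet_kernel _ _ _ (fun x => (~~ fconnect f x r)%:R) x0).
  by rewrite x0r oner_eq0.
move=> x; under eq_bigr do rewrite mulrBl.
rewrite sumrB (bigD1 x) //= eqxx mul1r big1 ?addr0; last first.
  by move=> z; rewrite eq_sym => /negPf->; rewrite mul0r.
have [->|xr] := eqVneq x r.
  by rewrite connect0 big1 ?subr0 // => z _; rewrite mul0r.
rewrite (bigD1 (f x)) //= eqxx mul1r big1 ?addr0; last first.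
  by move=> z; rewrite eq_sym => /negPf->; rewrite mul0r.
suff -> : fconnect f x r = fconnect f (f x) r by rewrite subrr.
apply/idP/idP => [xcr|]; last by apply: connect_trans; apply: fconnect1.
have := iter_findex xcr; rewrite fconnect_findex //; last by rewrite eq_sym.
by rewrite iterSr => <-; apply: fconnect_iter.
Qed.

(** The minor of the Laplacian at [r] counts the rooted trees: expanding each
    row [x] as the sum over the neighbours [k] of [x] leaves one matrix for
    every choice function, unimodular or singular according to
    [fdet_parent]. *)
Lemma fdet_laplacian_minor (R : fieldType) :
  fdet (fun x y => if x == r then (x == y)%:R
                   else (degree x)%:R * (x == y)%:R - (adj x y)%:R) =
    #|[set f | parent_fun f]|%:R :> R.
Proof.
transitivity (fdet (fun x y => \sum_(k | parent_choice x k)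
    ((x == y)%:R - ((x != r) && (k == y))%:R : R))).
  apply: eq_fdet => x y; rewrite /parent_choice.
  have [->|xr] := eqVneq x r.
    by rewrite big_pred1_eq subr0.
  rewrite sumrB sumr_const mulr_natl; congr (_ *+ _ - _).
    by apply: eq_card => z; rewrite inE.
  case: (boolP (adj x y)) => [axy|naxy].
    rewrite (bigD1 y) //= eqxx big1 ?addr0 // => z /andP[_ /negPf->] //.
  by rewrite big1 // => z axz; case: eqP => // zy; rewrite -zy axz in naxy.
rewrite fdet_row_sum (eq_bigr (fun f => [forall x, fconnect f x r]%:R)); last first.
  by move=> f ff; apply: fdet_parent.
rewrite -natr_sum -sum1dep_card [in RHS]big_mkcondr; congr (_%:R).
Qed.

(** The edge set of the tree with parent function [f]. *)
Definition parent_edges f : {set {set G}} := [set [set x; f x] | x in [set~ r]].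

Lemma span_parent_edges f x y :
  span_rel (parent_edges f) x y =
    ((x != r) && (f x == y)) || ((y != r) && (f y == x)).
Proof.
rewrite /span_rel /=; apply/imsetP/idP => [[z]|].
  rewrite !inE => zr /eq_set2[] [-> ->]; first by rewrite zr eqxx.
  by rewrite zr eqxx orbT.
case/orP=> /andP[xr /eqP fx]; [exists x | exists y]; rewrite ?inE //.
  by rewrite fx.
by rewrite fx setUC.
Qed.

Lemma span_rel_sym S : symmetric (span_rel S).
Proof. by move=> x y; rewrite /span_rel /= setUC. Qed.

Lemma parent_edges_connected f :
  parent_fun f -> connected_rel (span_rel (parent_edges f)).
Proof.
move=> pf; apply/andP; split; first by apply/card_gt0P; exists r.
have to_r x : connect (span_rel (parent_edges f)) x r.
  apply: connect_sub (parent_fun_reach x pf) => y _ /eqP<-.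
  have [->|yr] := eqVneq y r; first by rewrite parent_fun_root.
  by apply: connect1; rewrite span_parent_edges yr eqxx.
apply/forallP=> x; apply/forallP=> y; apply: connect_trans (to_r x) _.
by rewrite (sym_connect_sym (span_rel_sym _)).
Qed.

(** A neighbour of [x] no farther from the root is the parent of [x]. *)
Lemma span_parent_edges_findex f x y :
  parent_fun f -> span_rel (parent_edges f) x y ->
  (findex f y r <= findex f x r)%N -> y = f x.
Proof.
move=> pf; rewrite span_parent_edges.
case/orP=> /andP[zr /eqP <-] //; by rewrite (findex_parent pf zr) ltnn.
Qed.

(** On a cycle, both neighbours of a vertex farthest from the root would be its
    parent. *)
Lemma parent_edges_acyclic f :
  parent_fun f -> acyclic_rel (span_rel (parent_edges f)).
Proof.
move=> pf; apply/forallP=> k; apply/forallP=> c; apply/negP=> /and3P[k2 Uc Cc].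
have [x0 x0c] : exists x0, x0 \in val c.
  case: c k2 {Uc Cc} => -[|x0 c] /= /eqP <- // _.
  by exists x0; rewrite mem_head.
have [x xc maxx] :=
  @arg_maxnP _ x0 (fun x => x \in val c) (fun x => findex f x r) x0c.
have [i c' rot_c] := rot_to xc.
have Uc' : uniq (x :: c') by rewrite -rot_c rot_uniq.
have Cc' : cycle (span_rel (parent_edges f)) (x :: c').
  by rewrite -rot_c rot_cycle.
have sz : (2 < size (x :: c'))%N by rewrite -rot_c size_rot size_tuple.
have far y : y \in c' -> (findex f y r <= findex f x r)%N.
  by move=> yc; apply: maxx; rewrite -(mem_rot i) rot_c inE yc orbT.
case: c' {rot_c} Uc' Cc' sz far => [|y c'] //.
case/lastP: c' => [|c' z] // Uxc Cxc _ far.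
move: Cxc; rewrite /= rcons_path last_rcons => /and3P[exy _ ezx].
have fy : y = f x.
  by apply: (span_parent_edges_findex pf exy); apply: far; rewrite mem_head.
have fz : z = f x.
  apply: (span_parent_edges_findex pf); first by rewrite span_rel_sym.
  by apply: far; rewrite inE mem_rcons mem_head orbT.
by move: Uxc; rewrite fy fz /= mem_rcons mem_head andbF.
Qed.

Lemma parent_edges_spanning_tree f :
  parent_fun f -> spanning_tree (parent_edges f).
Proof.
move=> pf; rewrite /spanning_tree parent_edges_connected //.
rewrite parent_edges_acyclic //.
rewrite !andbT; apply/subsetP=> e /imsetP[x]; rewrite !inE => xr ->.
apply/existsP; exists x; apply/existsP; exists (f x).
by rewrite parent_fun_adj //= eqxx.
Qed.

Lemma parent_edges_inj f g :
  parent_fun f -> parent_fun g -> parent_edges f = parent_edges g -> f = g.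
Proof.
move=> pf pg efg; apply/ffunP=> x; have [n] := ubnP (findex f x r).
elim: n x => // n IHn x; have [->|xr] := eqVneq x r.
  by rewrite !parent_fun_root.
rewrite (findex_parent pf xr) ltnS => ltn.
have : span_rel (parent_edges g) x (f x).
  by rewrite -efg span_parent_edges xr eqxx.
rewrite span_parent_edges => /orP[/andP[_ /eqP->] //|/andP[fxr /eqP gfx]].
(* Otherwise x and f x are each other's parents. *)
have ffx : f (f x) = x by rewrite -[RHS]gfx IHn.
have := findex_parent pf fxr; rewrite ffx (findex_parent pf xr) => /eqP.
by rewrite -[X in X == _]addn0 -[X in _ == X]addn2 eqn_add2l.
Qed.

(** Every connected relation has parent functions: step to a neighbour that
    starts a shorter path to the root. *)
Lemma connected_descent (e : rel G) :
  connected_rel e ->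
  exists2 f : {ffun G -> G}, f r = r /\ (forall x, x != r -> e x (f x))
                           & forall x, fconnect f x r.
Proof.
case/andP=> _ /forallP conn.
pose P x n := [exists p : n.-tuple G, path e x p && (last x p == r)].
have exP x : exists n, P x n.
  have /forallP/(_ r)/connectP[p xp rp] := conn x.
  by exists (size p); apply/existsP; exists (in_tuple p); rewrite xp -rp eqxx.
pose dist x := ex_minn (exP x).
have step x : x != r -> exists y, e x y && (dist y < dist x)%N.
  rewrite {2}/dist; case: ex_minnP => n /existsP[[p /= /eqP <-]].
  case: p => [|y p] /=; first by move=> ->.
  move=> /andP[/andP[exy yp] rp] _ _; exists y; rewrite exy ltnS /dist.
  case: ex_minnP => m _; apply; apply/existsP.
  by exists (in_tuple p); rewrite yp.
pose f := [ffun x => if x == r then r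
  else odflt r [pick y | e x y && (dist y < dist x)%N]].
have fP x : x != r -> e x (f x) && (dist (f x) < dist x)%N.
  move=> xr; rewrite /f ffunE (negPf xr); case: pickP => [y -> //|no].
  by have [y] := step x xr; rewrite no.
have fr : f r = r by rewrite ffunE eqxx.
exists f; first by split=> // x /fP/andP[].
move=> x; have [n] := ubnP (dist x); elim: n x => // n IHn x dx.
have [->|xr] := eqVneq x r; first exact: connect0.
have /andP[_ lt_d] := fP x xr; apply: connect_trans (fconnect1 f x) _.
by apply: IHn; apply: leq_trans lt_d _.
Qed.

Lemma spanning_tree_parent S :
  spanning_tree S -> exists2 f, parent_fun f & S = parent_edges f.
Proof.
case/and3P=> /subsetP sSE connS /forallP acycS.
have adjS x y : span_rel S x y -> adj x y.
  move=> /sSE; rewrite inE => /existsP[a /existsP[b /andP[ab /eqP/eq_set2]]].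
  by case=> -[-> ->]; rewrite // adj_sym.
have [f [fr fS] reach] := connected_descent connS.
have pf : parent_fun f.
  apply/andP; split; last exact/forallP.
  apply/familyP=> x; rewrite unfold_in; have [->|xr] := eqVneq x r.
    by rewrite fr.
  exact/adjS/fS.
exists f => //; apply/eqP; rewrite eqEsubset; apply/andP; split; last first.
  by apply/subsetP=> e /imsetP[x]; rewrite !inE => /fS + ->.
apply/subsetP=> e eS; have := sSE _ eS; rewrite inE.
case/existsP=> x /existsP[y /andP[xy /eqP def_e]]; subst e.
(* An extra edge would close a cycle with a path of the tree given by f. *)
apply: contraT => not_xy.
have /andP[_ /forallP/(_ x)/forallP/(_ y)/connectP[p0 xp0 lasty]] :=
  parent_edges_connected pf.
case/shortenP: xp0 lasty => p xp Uxp _ def_y.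
have sub : subrel (span_rel (parent_edges f)) (span_rel S).
  move=> a b; rewrite span_parent_edges.
  by case/orP=> /andP[zr /eqP <-]; rewrite ?fS // span_rel_sym fS.
have lt_sz : (size (x :: p) < #|G|.+1)%N.
  by rewrite ltnS -(card_uniqP Uxp) max_card.
have /forallP/(_ (in_tuple (x :: p)))/negP[] := acycS (Ordinal lt_sz).
apply/and3P; split=> //=; last first.
  rewrite rcons_path (sub_path sub xp) -def_y.
  by rewrite [span_rel S y x]span_rel_sym.
case: p xp def_y {lt_sz Uxp} => [|z [|]] //=.
  by move=> _ yx; rewrite yx adj_irr in xy.
by rewrite andbT => + zy; rewrite -zy /span_rel /= (negPf not_xy).
Qed.

Lemma card_parent_fun : #|[set f | parent_fun f]| = num_spanning_trees G.
Proof.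
rewrite /num_spanning_trees -(card_in_imset (f := parent_edges)).
  apply: eq_card => S; rewrite inE.
  apply/imsetP/idP => [[f]|/spanning_tree_parent[f pf ->]].
    by rewrite inE => /parent_edges_spanning_tree + ->.
  by exists f; rewrite ?inE.
by move=> f g; rewrite !inE; apply: parent_edges_inj.
Qed.

End ParentFunctions.

Lemma degreeE (R : pzRingType) (G : sgraph) (x : G) :
  (degree x)%:R = \sum_y (adj x y)%:R :> R.
Proof.
rewrite /degree -sum1dep_card natr_sum big_mkcond; apply: eq_bigr => y _.
by case: (adj x y).
Qed.

(** The weighted form of the matrix-tree theorem. *)
Theorem laplacian_rank1_spanning_trees (R : fieldType) (G : sgraph) (r : G)
    (u v : G -> R) :
  fdet (fun x y => (degree x)%:R * (x == y)%:R - (adj x y)%:R + u x * v y) =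
    (\sum_x u x) * (\sum_y v y) * (num_spanning_trees G)%:R.
Proof.
have row0 (x : G) : \sum_y ((degree x)%:R * (x == y)%:R - (adj x y)%:R) = 0 :> R.
  rewrite sumrB -degreeE (bigD1 x) //= eqxx mulr1 big1 ?addr0 ?subrr // => y.
  by rewrite eq_sym => /negPf->; rewrite mulr0.
rewrite (fdet_zero_sum_rank1 r) //; first last.
  move=> y; rewrite -[RHS](row0 y); apply: eq_bigr => x _.
  by rewrite adj_sym [y == x]eq_sym; case: eqP => [->|]; rewrite ?mulr0.
by rewrite fdet_laplacian_minor card_parent_fun.
Qed.

(** * Extreme eigenvalues *)

Lemma degree_enum (R : pzRingType) (G : sgraph) (i : 'I_#|G|) :
  (degree (enum_val i))%:R =
    \sum_(j < #|G|) (adj (enum_val j) (enum_val i))%:R :> R.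
Proof.
rewrite degreeE (reindex (@enum_val G G)) /=; last exact: onW_bij (@enum_val_bij G).
by apply: eq_bigr => j _; rewrite adj_sym.
Qed.

Lemma mem_eigenvalues n (M : 'M[algC]_n) a :
  (a \in eigenvalues M) = eigenvalue M a.
Proof. by rewrite eigenvalue_root_char eigenvaluesP root_prod_XsubC. Qed.

Lemma det_add_scalar n (M : 'M[algC]_n) c :
  \det (c%:M + M) = \prod_(x <- eigenvalues M) (c + x).
Proof.
have sgn0 : (-1) ^+ n != 0 :> algC by rewrite signr_eq0.
apply: (mulfI sgn0); transitivity (char_poly M).[- c].
  rewrite -detZ -horner_evalE -det_map_mx; congr (\det _).
  apply/matrixP=> i j; rewrite !mxE /= horner_evalE !hornerE.
  by rewrite hornerMn hornerX mulNrn mulN1r opprD.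
rewrite eigenvaluesP horner_prod -[X in _ = (-1) ^+ X * _](size_eigenvalues M).
elim: (eigenvalues M) => [|x s IHs]; first by rewrite !big_nil mulr1.
by rewrite !big_cons IHs hornerXsubC /= exprS; ring.
Qed.

(** Gershgorin's circle theorem, for columns. *)
Lemma eigenvalue_gershgorin n (M : 'M[algC]_n) a :
  eigenvalue M a -> exists i, `|a - M i i| <= \sum_(j | j != i) `|M j i|.
Proof.
case/eigenvalueP=> v vM v0.
have [i0 vi0] : exists i, v 0 i != 0.
  apply/existsP; apply: contraR v0; rewrite negb_exists => /forallP v0.
  by apply/eqP/rowP=> i; rewrite mxE; apply/eqP; rewrite -[_ == _]negbK.
have [i _ maxi] : extremum_spec >=%R predT (fun i => `|v 0 i|)
    [arg max_(i > i0 | predT i) `|v 0 i|]%O.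
  by apply: real_arg_maxP => // j _; apply: normr_real.
have vi_gt0 : 0 < `|v 0 i|.
  by apply: lt_le_trans (maxi i0 isT); rewrite normr_gt0.
exists i; rewrite -(ler_pM2r vi_gt0) -normrM mulr_suml.
have -> : (a - M i i) * v 0 i = \sum_(j | j != i) v 0 j * M j i.
  move/rowP/(_ i): vM; rewrite !mxE (bigD1 i) //= mulrBl => <-.
  by rewrite [M i i * _]mulrC addrAC subrr add0r.
apply: le_trans (ler_norm_sum _ _ _) _; apply: ler_sum => j _.
by rewrite normrM mulrC ler_wpM2l //; apply: maxi.
Qed.

Lemma eigenvalue_real_sym n (M : 'M[algC]_n) a :
  M^T = M -> (forall i j, M i j \is Num.real) -> eigenvalue M a ->
  a \is Num.real.
Proof.
move=> /matrixP symM realM /eigenvalueP[v vM v0].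
pose s := \sum_i v 0 i * (v 0 i)^*.
have s_gt0 : 0 < s.
  rewrite lt_def sumr_ge0 ?andbT => [|i _]; last exact: mul_conjC_ge0.
  apply: contra v0; rewrite psumr_eq0 => [/allP s0|i _]; last exact: mul_conjC_ge0.
  apply/eqP/rowP=> i; rewrite mxE; apply/eqP.
  by rewrite -mul_conjC_eq0; apply: s0; rewrite mem_index_enum.
have eq_as : a * s = \sum_i \sum_j v 0 j * M j i * (v 0 i)^*.
  rewrite mulr_sumr; apply: eq_bigr => i _; move/rowP/(_ i): vM; rewrite !mxE.
  by rewrite -mulr_suml mulrA => ->.
apply/CrealP; apply: (mulIf (lt0r_neq0 s_gt0)).
have conj_s : s^* = s by apply/CrealP; rewrite ger0_real // ltW.
rewrite -{1}conj_s -rmorphM eq_as rmorph_sum [RHS]exchange_big /=.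
apply: eq_bigr => i _; rewrite rmorph_sum /=; apply: eq_bigr => j _.
rewrite !rmorphM /= conjCK (CrealP (realM _ _)) -[M i j]symM mxE; ring.
Qed.

(** Splitting off the head [m] of a sorted list; only the members of the list
    need to be comparable. *)
Lemma prod_sort_head (le : rel algC) (s : seq algC) m (F : algC -> algC) :
  {in s &, total le} -> transitive le -> antisymmetric le ->
  m \in s -> {in s, forall x, le m x} ->
  \prod_(x <- s) F x =
    F m * \prod_(2 <= i < (size s).+1) F (sort le s)`_i.-1.
Proof.
move=> tot tr anti ms minm.
have sorted_s : sorted le (sort le s) by apply: sort_sorted_in tot _ _; apply/allP.
rewrite -(size_sort le s) -(perm_big _ (permEl (perm_sort le s))) /=.
case def_t: (sort le s) sorted_s => [|y t] /=.
  by move: ms; rewrite -(mem_sort le) def_t.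
move=> le_yt; have ym : y = m.
  apply: anti; apply/andP; split; last first.
    by apply: minm; rewrite -(mem_sort le) def_t mem_head.
  move: ms; rewrite -(mem_sort le) def_t inE => /predU1P[->|].
    have ys : y \in s by rewrite -(mem_sort le) def_t mem_head.
    by have := tot y y ys ys; rewrite orbb.
  by move/(allP (order_path_min tr le_yt)).
by rewrite big_cons ym !big_add1 /= (big_nth 0).
Qed.

Lemma adjmx_sym G : (adjmx G)^T = adjmx G.
Proof. by apply/matrixP=> i j; rewrite !mxE adj_sym. Qed.

Lemma adjmx_eigenvalue_real G a : eigenvalue (adjmx G) a -> a \is Num.real.
Proof.
apply: eigenvalue_real_sym (adjmx_sym G) _ => i j.
by rewrite mxE realn.
Qed.

Lemma laplmx_eigenvalue_real G a : eigenvalue (laplmx G) a -> a \is Num.real.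
Proof.
apply: eigenvalue_real_sym => [|i j]; last first.
  by rewrite !mxE rpredB ?rpredMn ?real1.
by rewrite linearB /= tr_diag_mx adjmx_sym.
Qed.

Lemma adjmx_regular_max G r a : regular r G -> eigenvalue (adjmx G) a -> a <= r%:R.
Proof.
move=> regG eva; have [i] := eigenvalue_gershgorin eva.
rewrite mxE adj_irr subr0 => le_a.
apply: le_trans (real_ler_norm (adjmx_eigenvalue_real eva)) _.
apply: le_trans le_a _; rewrite -(regG (enum_val i)) degree_enum.
rewrite [leRHS](bigD1 i) //= adj_irr add0r ler_sum // => j _.
by rewrite mxE normr_nat.
Qed.

Lemma laplmx_ge0 G a : eigenvalue (laplmx G) a -> 0 <= a.
Proof.
move=> eva; have [i] := eigenvalue_gershgorin eva.
have areal := laplmx_eigenvalue_real eva.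
rewrite !mxE eqxx mulr1n adj_irr subr0 => le_a.
have {}le_a : `|a - (degree (enum_val i))%:R| <= (degree (enum_val i))%:R.
  apply: le_trans le_a _.
  rewrite [leRHS]degree_enum [leRHS](bigD1 i) //= adj_irr add0r ler_sum // => j ji.
  by rewrite !mxE (negPf ji) mulr0n sub0r normrN normr_nat.
move: le_a; rewrite real_ler_norml; last by rewrite rpredB ?realn.
by case/andP; rewrite lerBrDr addNr.
Qed.

Lemma adjmx_regular_eigenvalue (G : sgraph) r : (0 < #|G|)%N -> regular r G ->
  eigenvalue (adjmx G) r%:R.
Proof.
move=> /card_gt0P[x _] regG; apply/eigenvalueP; exists (const_mx 1).
  apply/rowP=> i; rewrite !mxE mulr1 -(regG (enum_val i)) degree_enum.
  by apply: eq_bigr => j _; rewrite !mxE mul1r.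
by apply/eqP=> /rowP/(_ (enum_rank x))/eqP; rewrite !mxE oner_eq0.
Qed.

Lemma laplmx_eigenvalue0 (G : sgraph) : (0 < #|G|)%N -> eigenvalue (laplmx G) 0.
Proof.
move=> /card_gt0P[x _]; apply/eigenvalueP; exists (const_mx 1).
  apply/rowP=> i; rewrite !mxE mul0r.
  rewrite (eq_bigr (fun j => (degree (enum_val j))%:R *+ (j == i)
     - (adj (enum_val j) (enum_val i))%:R)) => [|j _]; last by rewrite !mxE mul1r.
  rewrite sumrB -degree_enum (bigD1 i) //= eqxx big1 ?addr0 ?subrr //.
  by move=> j /negPf->.
by apply/eqP=> /rowP/(_ (enum_rank x))/eqP; rewrite !mxE oner_eq0.
Qed.

Lemma fdet_scalar_adj (G : sgraph) r c :
  (0 < #|G|)%N -> regular r G ->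
  fdet (fun x y : G => c * (x == y)%:R + (adj x y)%:R) =
    (c + r%:R) * \prod_(2 <= i < #|G|.+1) (c + lambda_ G i).
Proof.
move=> G0 regG.
transitivity (\det (c%:M + adjmx G)).
  congr (\det _); apply/matrixP=> i j.
  by rewrite !mxE (inj_eq enum_val_inj) mulr_natr.
rewrite det_add_scalar -[in RHS](size_eigenvalues (adjmx G)).
apply: (@prod_sort_head >=%R) => [a b|a b d|a b||a].
- rewrite !mem_eigenvalues => /adjmx_eigenvalue_real ra /adjmx_eigenvalue_real rb.
  by rewrite orbC; apply: real_leVge.
- by move=> ba db; apply: le_trans db ba.
- by rewrite andbC => /le_anti.
- by rewrite mem_eigenvalues adjmx_regular_eigenvalue.
- by rewrite mem_eigenvalues; apply: adjmx_regular_max.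
Qed.

Lemma fdet_one_laplacian (G : sgraph) :
  (0 < #|G|)%N ->
  fdet (fun x y : G => (degree x).+1%:R * (x == y)%:R - (adj x y)%:R) =
    \prod_(2 <= i < #|G|.+1) (1 + mu_ G i).
Proof.
move=> G0.
transitivity (\det (1%:M + laplmx G)).
  congr (\det _); apply/matrixP=> i j.
  rewrite !mxE (inj_eq enum_val_inj) -natr1; case: eqP => _ /=; ring.
rewrite det_add_scalar -[in RHS](size_eigenvalues (laplmx G)).
rewrite -[RHS]mul1r -[X in _ = X * _]addr0.
apply: (@prod_sort_head <=%R _ 0 (fun x => 1 + x)) => [a b|a b d|a b||a].
- rewrite !mem_eigenvalues => /laplmx_eigenvalue_real ra /laplmx_eigenvalue_real rb.
  exact: real_leVge.
- exact: le_trans.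
- exact: le_anti.
- by rewrite mem_eigenvalues laplmx_eigenvalue0.
- by rewrite mem_eigenvalues; apply: laplmx_ge0.
Qed.

(** * Edge-vertex incidences *)

Lemma edge_of_members (G : sgraph) (e : {set G}) x y :
  e \in edges G -> x \in e -> y \in e -> x != y -> adj x y /\ e = [set x; y].
Proof.
rewrite inE => /existsP[a /existsP[b /andP[ab /eqP->]]]; rewrite !inE.
by case/orP=> /eqP->; case/orP=> /eqP->; rewrite ?eqxx // setUC adj_sym.
Qed.

Lemma mem_edges (G : sgraph) (x y : G) : ([set x; y] \in edges G) = adj x y.
Proof.
apply/idP/idP => [|axy]; last first.
  by rewrite inE; apply/existsP; exists x; apply/existsP; exists y; rewrite axy eqxx.
rewrite inE => /existsP[a /existsP[b /andP[ab /eqP/eq_set2]]].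
by case=> -[-> ->]; rewrite // adj_sym.
Qed.

Lemma card_edge (G : sgraph) (e : {set G}) : e \in edges G -> #|e| = 2%N.
Proof.
rewrite inE => /existsP[a /existsP[b /andP[ab /eqP->]]].
by rewrite cards2; case: eqP ab => // ->; rewrite adj_irr.
Qed.

Lemma card_edges_at (G : sgraph) (x : G) :
  #|[set e in edges G | x \in e]| = degree x.
Proof.
rewrite /degree -(card_in_imset (f := fun z => [set x; z])); last first.
  by move=> z z' _ _ /eq_set2[] [] // -> ->.
apply: eq_card => e; rewrite inE; apply/andP/imsetP => [[eE xe]|[z + ->]].
  have /card_gt0P[z] : (0 < #|e :\ x|)%N.
    by have := cardsD1 x e; rewrite card_edge // xe add1n => -[<-].
  rewrite !inE => /andP[zx ze]; have [|axz ->] := edge_of_members eE xe ze.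
    by rewrite eq_sym.
  by exists z; rewrite ?inE.
by rewrite inE => axz; rewrite mem_edges !inE eqxx.
Qed.

(** The product of the vertex-edge incidence matrix with its transpose. *)
Lemma sum_incidence (R : pzRingType) (G : sgraph) (x y : G) :
  \sum_(e : {e : {set G} | e \in edges G})
     (x \in val e)%:R * (y \in val e)%:R =
  (degree x)%:R * (x == y)%:R + (adj x y)%:R :> R.
Proof.
rewrite -(big_sub (edges G) (fun e => (x \in e)%:R * (y \in e)%:R)) /=.
transitivity (\sum_(e in edges G | (x \in e) && (y \in e)) 1%:R : R).
  rewrite [RHS]big_mkcondr; apply: eq_bigr => e _.
  by case: (x \in e); case: (y \in e); rewrite ?mulr1 ?mulr0.
rewrite -natr_sum; have [<-|nxy] := eqVneq x y.
  rewrite adj_irr mulr1 addr0 -card_edges_at -sum1dep_card; congr (_%:R).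
  by apply: eq_bigl => e; rewrite andbb.
rewrite mulr0 add0r; congr (_%:R); case: (boolP (adj x y)) => axy.
  rewrite (big_pred1 [set x; y]) // => e.
  apply/andP/eqP => [[eE /andP[xe ye]]|->].
    by have [] := edge_of_members eE xe ye nxy.
  by rewrite mem_edges axy !inE !eqxx orbT.
rewrite big_pred0 // => e; apply/negP => /andP[eE /andP[xe ye]].
by have [] := edge_of_members eE xe ye nxy; rewrite (negPf axy).
Qed.

Lemma sum_edge_members (R : pzRingType) (G : sgraph)
    (e : {e : {set G} | e \in edges G}) :
  \sum_(x : G) (x \in val e)%:R = 2%:R :> R.
Proof.
rewrite -(card_edge (valP e)) -sum1_card natr_sum [RHS]big_mkcond.
by apply: eq_bigr => x _; case: (x \in val e).
Qed.

Lemma sum_degrees (R : pzRingType) (G : sgraph) :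
  \sum_(x : G) (degree x)%:R = (2 * #|edges G|)%:R :> R.
Proof.
transitivity (\sum_(e : {e : {set G} | e \in edges G}) 2%:R : R).
  rewrite -[RHS](eq_bigr _ (fun e _ => sum_edge_members R e)) exchange_big.
  apply: eq_bigr => x _; have := sum_incidence R x x.
  rewrite eqxx adj_irr mulr1 addr0 => <-; apply: eq_bigr => e _.
  by case: (x \in val e); rewrite ?mulr1 ?mulr0.
by rewrite sumr_const card_sig natrM mulr_natr.
Qed.

(** * The central vertex corona *)

Section Corona.

Variables (G1 G2 : sgraph) (r1 : nat).
Hypothesis reg1 : regular r1 G1.

Let edge_type := {e : {set G1} | e \in edges G1}.
Let K := central_vertex_corona G1 G2.

Let sum_delta (T : finType) (x : T) (H : T -> algC) :
  \sum_z (x == z)%:R * H z = H x.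
Proof.
rewrite (bigD1 x) //= eqxx mul1r big1 ?addr0 // => z.
by rewrite eq_sym => /negPf->; rewrite mul0r.
Qed.

Let sum_delta1 (T : finType) (x : T) : \sum_z (x == z)%:R = 1 :> algC.
Proof.
by rewrite -[RHS](sum_delta x (fun=> 1)); under [RHS]eq_bigr do rewrite mulr1.
Qed.

Let sum_prod (T U : finType) (H : T * U -> algC) :
  \sum_p H p = \sum_x \sum_y H (x, y).
Proof. by rewrite pair_bigA; apply: eq_bigr => -[]. Qed.

Lemma corona_degree_copy (x : G1) (w : G2) :
  degree (inr (x, w) : K) = (degree w).+1.
Proof.
apply/eqP; rewrite -(eqr_nat algC) degreeE !big_sumType /=.
rewrite sum_prod /=.
rewrite (eq_bigr (fun y => (x == y)%:R)) => [|y _]; last first.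
  by rewrite /eq_op /= eq_sym.
rewrite sum_delta1 big1 // addr0.
rewrite (eq_bigr (fun y => (x == y)%:R * (degree w)%:R)) => [|y _].
  by rewrite sum_delta -natr1 addrC.
rewrite degreeE mulr_sumr; apply: eq_bigr => z _.
by rewrite -natrM mulnb.
Qed.

Lemma corona_degree_edge (e : edge_type) : degree (inl (inr e) : K) = 2%N.
Proof.
apply/eqP; rewrite -(eqr_nat algC) degreeE !big_sumType /=.
by rewrite sum_edge_members [X in _ + X + _]big1 // [X in _ + X]big1 ?addr0 // => -[].
Qed.

Lemma corona_degree_vertex (x : G1) :
  (degree (inl (inl x) : K))%:R = #|G1|%:R + #|G2|%:R - 1 :> algC.
Proof.
rewrite degreeE !big_sumType /=.
rewrite sum_prod /=.
rewrite (eq_bigr (fun y => 1 - (x == y)%:R - (adj x y)%:R)) => [|y _]; last first.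
  case: eqP => [->|_]; first by rewrite adj_irr subrr subr0.
  by case: (adj x y); rewrite subr0 ?subrr ?subr0.
rewrite !sumrB sum_delta1 -degreeE sumr_const.
rewrite (eq_bigr (fun y => (x == y)%:R * #|G2|%:R)) => [|y _]; last first.
  by rewrite sumr_const mulr_natr.
rewrite sum_delta.
rewrite (eq_bigr (fun e : edge_type =>
    (x \in val e)%:R * (x \in val e)%:R)) => [|e _]; last first.
  by case: (_ \in _); rewrite ?mulr1 ?mulr0.
by rewrite sum_incidence eqxx adj_irr mulr1 addr0; ring.
Qed.

(** The Laplacian of the corona perturbed by the all-ones block on the vertices
    of [G1], which turns the block of these vertices into a multiple of the
    identity plus the adjacency matrix of [G1]. *)
Lemma fdet_corona :
  (0 < #|G1|)%N -> (0 < #|G2|)%N ->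
  let u (x : K) : algC := (if x is inl (inl _) then 1 else 0) in
  fdet (fun x y : K =>
          (degree x)%:R * (x == y)%:R - (adj x y)%:R + u x * u y) =
    2^-1 ^+ #|G1| *
    ((2 * #|G1|)%:R *
     \prod_(2 <= i < #|G1|.+1) (2 * #|G1|%:R - r1%:R + lambda_ G1 i)) *
    2 ^+ #|edges G1| *
    (\prod_(2 <= i < #|G2|.+1) (1 + mu_ G2 i)) ^+ #|G1|.
Proof.
move=> G1_gt0 G2_gt0 u.
set F := fun x y : K => _.
have eqP1 (x y : G1) (w z : G2) :
    (inr (x, w) == inr (y, z) :> K) = (x == y) && (w == z) by [].
have eqP2 (x y : G1) : (inl (inl x) == inl (inl y) :> K) = (x == y) by [].
pose B (w z : G2) : algC := (degree w).+1%:R * (w == z)%:R - (adj w z)%:R.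
have Fcc (x y : G1) (w z : G2) :
    F (inr (x, w)) (inr (y, z)) = (x == y)%:R * B w z.
  rewrite /F corona_degree_copy eqP1 /= mulr0 addr0 /B.
  by case: (x == y); rewrite ?mul1r ?mul0r ?mulr0 ?subrr.
have Fcv (x y : G1) (w : G2) : F (inr (x, w)) (inl (inl y)) = - (x == y)%:R.
  by rewrite /F /= mul0r addr0 mulr0 sub0r eq_sym.
have Fvc (x y : G1) (w : G2) : F (inl (inl x)) (inr (y, w)) = - (x == y)%:R.
  by rewrite /F /= !mulr0 addr0 sub0r.
have Fce (x : G1 * G2) (e : edge_type) : F (inr x) (inl (inr e)) = 0.
  by case: x => x w; rewrite /F /= !mulr0 addr0 subr0.
have Fec (x : G1 * G2) (e : edge_type) : F (inl (inr e)) (inr x) = 0.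
  by case: x => x w; rewrite /F /= !mulr0 addr0 subr0.
have Fvv (x y : G1) :
    F (inl (inl x)) (inl (inl y)) =
      (#|G1|%:R + #|G2|%:R) * (x == y)%:R + (adj x y)%:R.
  rewrite /F corona_degree_vertex eqP2 /= mulr1.
  have [->|nxy] := eqVneq x y; rewrite ?adj_irr /=; first by ring.
  by case: (adj x y) => /=; ring.
have Fve (x : G1) (e : edge_type) :
    F (inl (inl x)) (inl (inr e)) = - (x \in val e)%:R.
  by rewrite /F /= !mulr0 addr0 sub0r.
have Fev (x : G1) (e : edge_type) :
    F (inl (inr e)) (inl (inl x)) = - (x \in val e)%:R.
  by rewrite /F /= !mulr0 mul0r addr0 sub0r.
have Fee (e e' : edge_type) :
    F (inl (inr e)) (inl (inr e')) = 2 * (e == e')%:R.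
  by rewrite /F corona_degree_edge /= mulr0 addr0 subr0.
have sumB w : \sum_z B w z = 1.
  rewrite sumrB -mulr_sumr sum_delta1 -degreeE -natr1; ring.
(* The copies of G2 are eliminated first: B is 1 + L(G2), which fixes the
   all-ones vector, so a column of ones per copy does it. *)
pose X (p : G1 * G2) (q : central_vertex G1) : algC :=
  if q is inl x then (p.1 == x)%:R else 0.
have step1 : fdet F =
    fdet (fun p q : central_vertex G1 =>
            F (inl p) (inl q) + \sum_v F (inl p) (inr v) * X v q) *
    fdet (fun p q : G1 * G2 => F (inr p) (inr q)).
  apply: (@fdet_schur algC (central_vertex G1) (G1 * G2)%type F X) => -[x w] [y|e].
    rewrite Fcv sum_prod (eq_bigr (fun z => (x == z)%:R * (z == y)%:R)).
      by rewrite sum_delta addNr.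
    move=> z _; rewrite (eq_bigr (fun t => (x == z)%:R * (z == y)%:R * B w t)).
      by rewrite -mulr_sumr sumB mulr1.
    by move=> t _; rewrite Fcc /=; ring.
  by rewrite Fce big1 ?addr0 // => v _; rewrite mulr0.
have copies : fdet (fun p q : G1 * G2 => F (inr p) (inr q)) =
    (\prod_(2 <= i < #|G2|.+1) (1 + mu_ G2 i)) ^+ #|G1|.
  rewrite -fdet_one_laplacian // -fdet_tensor1.
  by apply: eq_fdet => -[x w] [y z]; rewrite Fcc.
rewrite step1 copies; congr (_ * _).
pose C (p q : central_vertex G1) : algC := match p, q with
  | inl x, inl y => #|G1|%:R * (x == y)%:R + (adj x y)%:R
  | inl x, inr e => - (x \in val e)%:R
  | inr e, inl x => - (x \in val e)%:R
  | inr e, inr e' => 2 * (e == e')%:R end.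
have -> : fdet (fun p q : central_vertex G1 =>
            F (inl p) (inl q) + \sum_v F (inl p) (inr v) * X v q) = fdet C.
  apply: eq_fdet => -[x|e] [y|e'] /=.
  - rewrite Fvv sum_prod
      (eq_bigr (fun z => (x == z)%:R * - ((z == y)%:R * #|G2|%:R))).
      by rewrite sum_delta; ring.
    move=> z _; rewrite (eq_bigr (fun=> - ((x == z)%:R * (z == y)%:R))).
      by rewrite sumr_const -mulr_natr; ring.
    by move=> t _; rewrite Fvc mulNr.
  - by rewrite Fve big1 ?addr0 // => v _; rewrite mulr0.
  - by rewrite Fev big1 ?addr0 // => v _; rewrite Fec mul0r.
  - by rewrite Fee big1 ?addr0 // => v _; rewrite mulr0.
have two_neq0 : 2 != 0 :> algC by rewrite pnatr_eq0.
(* The subdividing vertices have degree 2, so half the incidence matrix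
   eliminates them. *)
pose Y (e : edge_type) (x : G1) : algC := 2^-1 * (x \in val e)%:R.
rewrite (@fdet_schur _ _ _ C Y) => [|e x]; last first.
  rewrite /= (eq_bigr (fun e' => (e == e')%:R * (2 * Y e' x))) => [|e' _];
    last by ring.
  by rewrite sum_delta mulVKf // addNr.
rewrite fdet_scalar card_sig; congr (_ * _).
have -> : (2 * #|G1|)%:R = (2 * #|G1|%:R - r1%:R) + r1%:R :> algC.
  by rewrite natrM subrK.
rewrite -fdet_scalar_adj // -fdet_scale; apply: eq_fdet => x y /=.
rewrite (eq_bigr (fun e : edge_type =>
    - 2^-1 * ((x \in val e)%:R * (y \in val e)%:R))) => [|e _];
  last by rewrite /Y; ring.
rewrite -mulr_sumr sum_incidence reg1.
by field.
Qed.

End Corona.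

Theorem corollary3p8 (G1 G2 : sgraph) (r1 n1 m1 n2 : nat)
    (conn1 : connected G1) (conn2 : connected G2)
    (reg1 : regular r1 G1)
    (cardV1 : #|G1| = n1) (cardE1 : #|edges G1| = m1) (cardV2 : #|G2| = n2) :
  (num_spanning_trees (central_vertex_corona G1 G2))%:R =
    (2 ^ (m1%:Z - n1%:Z) * (r1 + 2 * n2 + 2)%:R
     * (\prod_(2 <= j < n2.+1) (1 + mu_ G2 j) ^+ n1)
     * (\prod_(2 <= i < n1.+1) (2 * n1%:R - r1%:R + lambda_ G1 i)))
    / (n1 + m1 + n1 * n2)%:R :> algC.
Proof.
have G1_gt0 : (0 < #|G1|)%N by case/andP: conn1.
have G2_gt0 : (0 < #|G2|)%N by case/andP: conn2.
have /card_gt0P[r _] := G1_gt0.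
pose u (x : central_vertex_corona G1 G2) : algC :=
  if x is inl (inl _) then 1 else 0.
have sum_u : \sum_x u x = n1%:R.
  rewrite !big_sumType /= sumr_const cardV1.
  by rewrite [X in _ + X + _]big1 // [X in _ + X]big1 ?addr0.
have := @laplacian_rank1_spanning_trees _ (central_vertex_corona G1 G2)
  (inl (inl r)) u u.
rewrite (fdet_corona reg1 G1_gt0 G2_gt0) sum_u cardV1 cardV2 cardE1 => tree_eq.
have handshake : n1%:R * r1%:R = 2 * m1%:R :> algC.
  rewrite -[2 * _]natrM -cardE1 -sum_degrees.
  rewrite (eq_bigr (fun=> r1%:R)) => [|x _]; last by rewrite reg1.
  by rewrite sumr_const cardV1 -[RHS]mulr_natl.
have n1_neq0 : n1%:R != 0 :> algC by rewrite pnatr_eq0 -lt0n -cardV1.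
have N_neq0 : (n1 + m1 + n1 * n2)%:R != 0 :> algC.
  by rewrite pnatr_eq0 -lt0n -addnA addn_gt0 -cardV1 G1_gt0.
have factorE : (r1 + 2 * n2 + 2)%:R = 2 * (n1 + m1 + n1 * n2)%:R / n1%:R :> algC.
  apply: (mulfI n1_neq0); rewrite [RHS]mulrCA mulfV // mulr1.
  by rewrite !natrD !natrM !mulrDr handshake; ring.
have two_neq0 : 2 != 0 :> algC by rewrite pnatr_eq0.
have powE : 2 ^ (m1%:Z - n1%:Z) = 2 ^+ m1 / 2 ^+ n1 :> algC.
  by rewrite expfzDr // -exprnN.
(* tree_eq determines n1^2 times the number of spanning trees. *)
apply: (mulfI n1_neq0); apply: (mulfI n1_neq0); rewrite [LHS]mulrA -tree_eq.
rewrite powE factorE prodrXl natrM exprVn.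
move: (n1 + m1 + n1 * n2)%:R N_neq0 => N N_neq0.
by field; rewrite N_neq0 n1_neq0 expf_neq0.
Qed.
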